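(* Let $r\in\{1,\ldots,n-1\}$, let $\{A_1,\ldots,A_r\}$ be a subset of pairwise commuting constant matrices in $\mathbf{M}_n$, and let $g\in\mathbf{Sym}_n$ be a matrix function of the variables $\xi^1,\ldots,\xi^r$. If $$g_{,\xi^a}=A_a\,g\quad\text{for all }a\in\{1,\ldots,r\},$$ then $$g(\xi^1,\ldots,\xi^r)=e^{\xi^aA_a}\,g_0,$$ where $g_0$ is a constant matrix that satisfies $A_a g_0=g_0A_a^T$ for all $a\in\{1,\ldots,r\}$.
   Context: $\mathbf{M}_n$ is the set of all $n\times n$ matrices over $\mathbb{R}$; $\mathbf{Sym}_n$ is the set of all $n\times n$ real matrices $X$ with $X^T=X$. The notation $g_{,\xi^a}$ means the partial derivative $\partial g/\partial\xi^a$, and $\xi^aA_a$ denotes the sum $\sum_{a=1}^r\xi^aA_a$ (summation over the repeated index). *)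

(* Defs.v *)
From HB Require Import structures.
From mathcomp Require Import all_boot all_order all_algebra.
From mathcomp Require Import all_classical all_reals all_analysis.

Set Implicit Arguments.
Unset Strict Implicit.
Unset Printing Implicit Defensive.

Import Order.TTheory GRing.Theory Num.Theory.
Import numFieldNormedType.Exports.

Local Open Scope classical_set_scope.
Local Open Scope ring_scope.

Definition Sym (R : realType) (n : nat) : set 'M[R]_n := [set X | X^T = X].
Arguments Sym R n : clear implicits.

Definition mxexp_coeff (R : realType) (n : nat) (A : 'M[R]_n) : nat -> 'M[R]_n :=
  fun k => k`!%:R^-1 *: A ^+ k.

(* The limit is entrywise: the topology on matrices is the product topology,
   which is also the one induced by the max norm. *)
Definition mxexp (R : realType) (n : nat) (A : 'M[R]_n) : 'M[R]_n :=
  limn (series (mxexp_coeff A)).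

(* The point (xi^1, ..., xi^r) is the row vector xi, so the coordinate xi^a is
   xi 0 a and the coordinate directions are the rows delta_mx 0 a.  Existence of
   the partial derivative is part of the predicate. *)
Definition has_partial (R : realType) (r n : nat) (g : 'rV[R]_r -> 'M[R]_n)
    (a : 'I_r) (xi : 'rV[R]_r) (dg : 'M[R]_n) : Prop :=
  is_derive xi (delta_mx 0 a : 'rV[R]_r) g dg.

(* Main.v *)
(* With S xi the sum of the xi^a A_a, the map h xi := exp (- S xi) g xi has zero
   partial derivatives on U.  No differentiability beyond the partial derivatives
   is assumed, so h is first shown constant on balls (which are cubes for the max
   norm) by moving one coordinate at a time, and then on U by connectedness; g0 is
   its value.  Differentiating g^T = g makes A_a g symmetric, and this passes to
   A_a g0 since A_a commutes with exp (- S xi).  The exponential is differentiated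
   entrywise as a power series in one real variable, and exp (X + Y) is handled
   through the constancy of exp (- t X) exp (- t Y) exp (t (X + Y)). *)
Require Import Defs.
From HB Require Import structures.
From mathcomp Require Import all_boot all_order all_algebra.
From mathcomp Require Import all_classical all_reals all_analysis.
From mathcomp Require Import ring.
Import Order.TTheory GRing.Theory Num.Theory.
Import numFieldNormedType.Exports.
Local Open Scope classical_set_scope.
Local Open Scope ring_scope.

Set Implicit Arguments.
Unset Strict Implicit.

(** * Entrywise limits and derivatives of matrix functions *)

Lemma is_derive_mxP (R : realType) (V : normedModType R) m n
    (F : V -> 'M[R]_(m, n)) t v dF :
  is_derive t v F dF <-> forall i j, is_derive t v (fun s => F s i j) (dF i j).
Proof.
split=> [dFt i j|dFt].
  have Ft : derivable F t v by [].
  split; first exact: (derivable_mxP F t v).1.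
  by rewrite -(@derive_val _ _ _ t v F dF dFt) derive_mx// mxE.
have Ft : derivable F t v by apply/derivable_mxP => i j; have [] := dFt i j.
split=> //; rewrite derive_mx//; apply/matrixP => i j; rewrite mxE.
by have [] := dFt i j.
Qed.

Lemma is_derive_mulmx (R : realType) (V : normedModType R) m n p
    (F : V -> 'M[R]_(m, n)) (G : V -> 'M[R]_(n, p)) t v dF dG :
  is_derive t v F dF -> is_derive t v G dG ->
  is_derive t v (fun s => F s *m G s) (dF *m G t + F t *m dG).
Proof.
move=> /is_derive_mxP dFt /is_derive_mxP dGt; apply/is_derive_mxP => i j.
rewrite (_ : (fun s => _) =
    \sum_(k < n) ((fun s => F s i k) * (fun s => G s k j))); last first.
  by apply/funext => s; rewrite !mxE fct_sumE.
apply: (is_derive_eq (is_derive_sum (fun k => is_deriveM (dFt i k) (dGt k j)))).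
rewrite !mxE -big_split/=; apply: eq_bigr => k _.
by rewrite [LHS]addrC; congr (_ + _); rewrite ?scalerE /GRing.scale/= mulrC.
Qed.

Lemma cvg_mxP (R : realType) T (F : set_system T) {FF : Filter F} m n
    (f : T -> 'M[R]_(m, n)) (l : 'M[R]_(m, n)) :
  f @ F --> l <-> forall i j, (fun x => f x i j) @ F --> l i j.
Proof.
split=> [fl i j|fl].
  apply: (cvg_comp f (fun M : 'M[R]_(m, n) => M i j) fl); exact: coord_continuous.
apply/cvgrPdist_le => e e0; near=> x.
rewrite [leLHS]/Num.Def.normr/= mx_normrE (bigmax_le _ (ltW e0))//= => i _.
rewrite !mxE; move: i; near: x; apply: filter_forall => /= i.
by move: (fl i.1 i.2) => /cvgrPdist_le; exact.
Unshelve. all: by end_near. Qed.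

Lemma cvg_mulmx (R : realType) T (F : set_system T) {FF : Filter F} m n p
    (f : T -> 'M[R]_(m, n)) (g : T -> 'M[R]_(n, p)) (a : 'M[R]_(m, n)) (b : 'M[R]_(n, p)) :
  f @ F --> a -> g @ F --> b -> (fun x => f x *m g x) @ F --> a *m b.
Proof.
move=> /cvg_mxP fa /cvg_mxP gb; apply/cvg_mxP => i j.
under eq_fun do rewrite mxE.
rewrite mxE; apply: cvg_big => [|k _]; [exact: add_continuous|exact: cvgM].
Qed.

(** * Convergence of the exponential series *)

Lemma expr_scalemx (R : comPzRingType) n (t : R) (X : 'M[R]_n) k :
  (t *: X) ^+ k = t ^+ k *: X ^+ k.
Proof.
elim: k => [|k IHk]; first by rewrite !expr0 scale1r.
by rewrite !exprS IHk -!mulmxE -scalemxAl -scalemxAr scalerA.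
Qed.

Lemma norm_coord_le (R : realType) m n (B : 'M[R]_(m, n)) i j :
  `|B i j| <= `|B|.
Proof.
by rewrite [leRHS]/Num.Def.normr/= mx_normrE; exact: (le_bigmax _ _ (i, j)).
Qed.

(** Each factor [X] costs at most the sum [N] of all |X a b|, because [N] bounds every absolute row
    sum. *)
Lemma norm_exp_mulmx_coord_le (R : realType) n p (X : 'M[R]_n) (B : 'M[R]_(n, p)) k i j :
  `|(X ^+ k *m B) i j| <= (\sum_(a < n) \sum_(b < n) `|X a b|) ^+ k * `|B|.
Proof.
elim: k i j => [|k IHk] i j; first by rewrite !expr0 mul1mx mul1r norm_coord_le.
rewrite !exprS -mulmxE -mulmxA mxE (le_trans (ler_norm_sum _ _ _))//.
set N := \sum_(a < n) _ in IHk *.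
apply: (@le_trans _ _ (\sum_(b < n) `|X i b| * (N ^+ k * `|B|))).
  by apply: ler_sum => b _; rewrite normrM ler_wpM2l.
have N0 : 0 <= N by do 2![apply: sumr_ge0 => ? _].
rewrite -mulr_suml -mulrA ler_wpM2r ?mulr_ge0 ?exprn_ge0//.
rewrite [leRHS](bigD1 i)//= lerDl.
by do 2![apply: sumr_ge0 => ? _].
Qed.

(** Comparison with |B| times the scalar exponential series at [N] |t|. The factor [B] is carried
    along because term-by-term differentiation merely replaces [B] by [X *m B]. *)
Lemma is_cvg_mxexp_coord (R : realType) n p (X : 'M[R]_n) (B : 'M[R]_(n, p)) i j t :
  cvgn (pseries (fun k => k`!%:R^-1 * (X ^+ k *m B) i j) t).
Proof.
set N := \sum_(a < n) \sum_(b < n) `|X a b|.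
have N0 : 0 <= N by do 2![apply: sumr_ge0 => ? _].
apply: normed_cvg; rewrite /normed_series_of/=.
apply: (@series_le_cvg _ _ (`|B| *: exp_coeff (N * `|t|))).
- by move=> k.
- by move=> k; rewrite mulr_ge0// exp_coeff_ge0// mulr_ge0.
- move=> k; rewrite exp_coeffE !normrM normrX ger0_norm//.
  rewrite [leRHS](_ : _ = k`!%:R^-1 * (N ^+ k * `|B|) * `|t| ^+ k); last first.
    by rewrite -[LHS]/(`|B| * (_ * (N * `|t|) ^+ k)) exprMn; ring.
  by rewrite ler_wpM2r ?exprn_ge0// ler_wpM2l// norm_exp_mulmx_coord_le.
- exact/is_cvg_seriesZ/is_cvg_series_exp_coeff.
Qed.

Lemma cvg_mxexp (R : realType) n (X : 'M[R]_n) :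
  series (mxexp_coeff X) @ \oo --> mxexp X.
Proof.
suff: cvgn (series (mxexp_coeff X)) by [].
apply/cvg_ex; exists (\matrix_(i, j) limn (pseries (fun k => k`!%:R^-1 * (X ^+ k *m 1%:M) i j) 1)).
apply/cvg_mxP => i j; rewrite mxE.
rewrite (_ : (fun k => _) = pseries (fun k => k`!%:R^-1 * (X ^+ k *m 1%:M) i j) 1).
  exact: is_cvg_mxexp_coord.
apply/funext => k; rewrite /series/= summxE; apply: eq_bigr => l _.
by rewrite mxE /= expr1n mulr1 mulmx1.
Qed.

Arguments cvg_mxexp {R n} X.

Lemma mxexp_unique (R : realType) n (X E : 'M[R]_n) :
  series (mxexp_coeff X) @ \oo --> E -> mxexp X = E.
Proof. by move=> h; apply: cvg_lim. Qed.

(** * Commutation with the exponential, and its derivative *)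

Lemma comm_mxexp (R : realType) n (B X : 'M[R]_n) :
  B *m X = X *m B -> B *m mxexp X = mxexp X *m B.
Proof.
move=> BX.
rewrite -[RHS](cvg_lim _ (cvg_mulmx (cvg_mxexp X) (cvg_cst B)))//.
apply/esym/cvg_lim => //.
rewrite (_ : (fun k => _) = (fun k => B *m series (mxexp_coeff X) k)).
  exact: cvg_mulmx (cvg_cst B) (cvg_mxexp X).
apply/funext => k; rewrite /series/= mulmx_sumr mulmx_suml.
apply: eq_bigr => i _; rewrite /mxexp_coeff -scalemxAr -scalemxAl.
by congr (_ *: _); apply/esym; exact: (@commrX 'M[R]_n).
Qed.

Lemma mxexp0 (R : realType) n : mxexp (0 : 'M[R]_n) = 1%:M.
Proof.
apply: mxexp_unique; apply: cvg_near_cst; near=> k.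
(* The partial sum is empty at [k = 0]; from [k = 1] on it is constantly 1. *)
have k0 : (0 < k)%N by near: k; exact: nbhs_infty_gt.
rewrite /series/= big_ltn// big_nat big1 ?addr0 => [|i /andP[i0 _]].
  by rewrite /mxexp_coeff expr0 fact0 invr1 scale1r.
by rewrite /mxexp_coeff expr0n -(prednK i0) scaler0.
Unshelve. all: by end_near. Qed.

(** Makes each entry a real power series in [t], ready for term-by-term differentiation. Commutation
    moves [B] to the right, where the coefficients carry it. *)
Lemma mulmx_mxexp_coord (R : realType) n (B X : 'M[R]_n) i j t : B *m X = X *m B ->
  (B *m mxexp (t *: X)) i j =
  limn (pseries (fun k => k`!%:R^-1 * (X ^+ k *m B) i j) t).
Proof.
move=> BX; apply/esym/cvg_lim => //.
have BtX : B *m (t *: X) = t *: X *m B by rewrite -scalemxAr BX scalemxAl.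
rewrite comm_mxexp//.
have : series (mxexp_coeff (t *: X)) k *m B @[k --> \oo] --> mxexp (t *: X) *m B.
  exact: cvg_mulmx (cvg_mxexp _) (cvg_cst B).
move=> /cvg_mxP/(_ i j).
rewrite (_ : (fun k => _) = pseries (fun k => k`!%:R^-1 * (X ^+ k *m B) i j) t)//.
apply/funext => k; rewrite /pseries/series/= mulmx_suml summxE; apply: eq_bigr => l _.
rewrite /mxexp_coeff -scalemxAl mxE -mulrA; congr (_ * _).
by rewrite expr_scalemx -scalemxAl mxE mulrC.
Qed.

Lemma is_derive_mxexp (R : realType) n (X : 'M[R]_n) (t : R) :
  is_derive t 1 (fun s => mxexp (s *: X)) (X *m mxexp (t *: X)).
Proof.
apply/is_derive_mxP => i j.
pose c (B : 'M[R]_n) k := k`!%:R^-1 * (X ^+ k *m B) i j.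
(* The factor k+1 turns 1/(k+1)! into 1/k!, and the extra power of [X] is absorbed into [B]. *)
have diffs_c B : pseries_diffs (c B) = c (X *m B).
  apply/funext => k; rewrite /pseries_diffs /c factS natrM invfM mulrA mulVKf//.
  by rewrite exprSr -mulmxE -mulmxA.
rewrite (_ : (fun s => _) = (fun s => limn (pseries (c 1%:M) s))); last first.
  by apply/funext => s; rewrite -mulmx_mxexp_coord ?mul1mx ?mulmx1.
rewrite mulmx_mxexp_coord//.
rewrite (_ : (fun k => _) = pseries_diffs (c 1%:M)); last by rewrite diffs_c mulmx1.
(* The series and its first two formal derivatives must converge at some point beyond |t|; any such
   point would do. *)
apply: (@pseries_snd_diffs _ _ (`|t| + 1)).
- exact: is_cvg_mxexp_coord.
- rewrite diffs_c; exact: is_cvg_mxexp_coord.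
- rewrite !diffs_c; exact: is_cvg_mxexp_coord.
- by rewrite [ltRHS]ger0_norm ?addr_ge0// ltrDl.
Qed.

(** * Zero derivative on a segment, and the exponential of a sum *)

Lemma segment_mx_cst (R : realType) m n (F : R -> 'M[R]_(m, n)) (a b : R) :
  a <= b -> (forall t, a <= t <= b -> is_derive t 1 F 0) -> F a = F b.
Proof.
move=> ab dF; apply/matrixP => i j.
have dFij t : a <= t <= b -> is_derive t 1 (fun s => F s i j) 0.
  by move=> /dF/is_derive_mxP/(_ i j); rewrite mxE.
have [||t _ /eqP] := @MVT_segment R (fun s => F s i j) (fun=> 0) a b ab.
- by move=> t /andP[/= ? ?]; apply: dFij; rewrite !ltW.
- apply: derivable_within_continuous => t; rewrite in_itv/= => /dFij ?; exact: ex_derive.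
by rewrite mul0r subr_eq0 => /eqP.
Qed.

(** This identity serves twice: [Y = 0] gives inverses, and with these it yields the addition
    law. *)
Lemma mxexpND (R : realType) n (X Y : 'M[R]_n) : X *m Y = Y *m X ->
  mxexp (- X) *m mxexp (- Y) *m mxexp (X + Y) = 1%:M.
Proof.
move=> XY.
pose E (Z : 'M[R]_n) (t : R) : 'M[R]_n := mxexp (t *: Z).
pose F t := E (- X) t *m E (- Y) t *m E (X + Y) t.
have commE B Z t : B *m Z = Z *m B -> B *m E Z t = E Z t *m B.
  by move=> BZ; apply: comm_mxexp; rewrite -scalemxAr BZ scalemxAl.
have F'0 (t : R) : is_derive t 1 F 0.
  apply: (is_derive_eq (is_derive_mulmx (is_derive_mulmx (is_derive_mxexp _ _)
    (is_derive_mxexp _ _)) (is_derive_mxexp _ _))).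
  (* The factors [- X] and [- Y] are pulled to the front, where they add up to [- (X + Y)]; the
     factor [X + Y] of the last term is pulled there too and cancels them. *)
  rewrite -!/(E _ _) (mulmxA (E (- X) t)) -(commE (- Y) (- X)); last first.
    by rewrite !mulmxN !mulNmx XY.
  rewrite -(mulmxA (- X)) -(mulmxA (- Y)) -mulmxDl -opprD.
  rewrite (mulmxA _ (X + Y)) -(mulmxA _ _ (X + Y)) -(commE (X + Y)); last first.
    by rewrite mulmxN mulNmx mulmxDl mulmxDr XY.
  rewrite (mulmxA _ (X + Y)) -(commE (X + Y)); last first.
    by rewrite mulmxN mulNmx mulmxDl mulmxDr XY.
  by rewrite !mulNmx !mulmxA addNr.
have := segment_mx_cst (F := F) (@ler01 R) (fun t _ => F'0 t).
by rewrite /F /E !scale0r !scale1r !mxexp0 !mulmx1 => <-.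
Qed.

Lemma mulNmxexp (R : realType) n (X : 'M[R]_n) :
  mxexp (- X) *m mxexp X = 1%:M.
Proof.
have := @mxexpND R n X 0; rewrite mulmx0 mul0mx oppr0 mxexp0 mulmx1 addr0.
exact.
Qed.

(** The order [Y], [X] on the right lets the factors cancel from the inside against those of
    [mxexpND]. *)
Lemma mxexpD (R : realType) n (X Y : 'M[R]_n) : X *m Y = Y *m X ->
  mxexp (X + Y) = mxexp Y *m mxexp X.
Proof.
move=> /mxexpND XY.
rewrite -[RHS]mulmx1 -XY !mulmxA.
have mulmxexpN Z : mxexp Z *m mxexp (- Z) = 1%:M :> 'M[R]_n.
  by rewrite -{1}[Z]opprK mulNmxexp.
by rewrite -[mxexp Y *m _ *m _]mulmxA mulmxexpN mulmx1 mulmxexpN mul1mx.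
Qed.

(** * From zero partial derivatives to constancy *)

Lemma is_derive_lineP (R : realType) (V W : normedModType R) (f : V -> W) x v df :
  is_derive x v f df <-> is_derive (0 : R) 1 (fun s => f (s *: v + x)) df.
Proof.
have eqD : 'D_1 (fun s : R => f (s *: v + x)) 0 = 'D_v f x.
  rewrite /derive; set p := fun s => _; set q := fun s => _.
  suff -> : p = q by []; apply/funext => s; rewrite /p /q /=.
  by rewrite addr0 scale0r add0r [_%:A]mulr1.
split=> -[fx <-]; split; rewrite ?eqD//; first exact: (derivable1P f x v).1.
exact: (derivable1P f x v).2.
Qed.

(** Restarting the line at [s *: v + x] shifts the parameter to 0. Directional derivatives thus
    become ordinary ones along a whole segment. *)
Lemma is_derive_line (R : realType) (V W : normedModType R) (f : V -> W) x v (s : R) df :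
  is_derive (s *: v + x) v f df -> is_derive s 1 (fun s => f (s *: v + x)) df.
Proof.
move=> /is_derive_lineP df0; apply/is_derive_lineP.
rewrite (_ : (fun t => _) = (fun t => f (t *: v + (s *: v + x))))//.
by apply/funext => t; rewrite [t *: 1]mulr1 scalerDl addrA.
Qed.

Lemma zero_partial_ball_cst (R : realType) r m n (h : 'rV[R]_r -> 'M[R]_(m, n))
    (x : 'rV[R]_r) e :
  (forall y : 'rV[R]_r, ball x e y -> forall a, is_derive y (delta_mx 0 a) h 0) ->
  forall y : 'rV[R]_r, ball x e y -> h y = h x.
Proof.
move=> dh y xy.
have e0 : 0 < e by case: xy.
have {}xy b : `|x 0 b - y 0 b| < e by case: xy => _ /(_ 0 b).
(* A path of corners from [x] at [k = 0] to [y] at [k = r], with the first [k] coordinates already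
   moved. *)
pose z k := \row_b (if (b < k)%N then y 0 b else x 0 b).
suff hz k : (k <= r)%N -> h (z k) = h x.
  by rewrite -(hz r)//; congr h; apply/rowP => b; rewrite mxE ltn_ord.
elim: k => [_|k IHk kr]; first by congr h; apply/rowP => b; rewrite mxE.
rewrite -IHk 1?ltnW//.
pose a := Ordinal kr; pose d := y 0 a - x 0 a.
pose F s := h (s *: delta_mx 0 a + z k).
have -> : h (z k) = F 0 by rewrite /F scale0r add0r.
have -> : h (z k.+1) = F d.
  congr h; apply/rowP => b; rewrite !mxE/= ltnS leq_eqVlt -(inj_eq val_inj b a)/=.
  case: eqP => [bk|_]/=; last by rewrite mulr0 add0r.
  have -> : b = a by exact: val_inj.
  by rewrite ltnn mulr1 subrK.
(* The path stays in the cube: coordinate [a] is off by |t| <= |d| < e, and every other one agrees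
   with [x] or [y]. *)
have dF (t : R) : `|t| <= `|d| -> is_derive t 1 F 0.
  move=> td; apply: is_derive_line; apply: dh; split=> // i b.
  rewrite ord1 /ball/= !mxE/=.
  have [->|ba] := eqVneq b a.
    rewrite ltnn mulr1 [_ + x _ _]addrC opprD addrA subrr sub0r normrN.
    by rewrite (le_lt_trans td)// distrC.
  by rewrite mulr0 add0r; case: ifP => // _; rewrite subrr normr0.
have [d0|d0] := leP 0 d.
  apply/esym/segment_mx_cst => // t /andP[t0 td]; apply: dF.
  by rewrite !ger0_norm.
apply: segment_mx_cst => [|t /andP[td t0]]; first exact: ltW.
by apply: dF; rewrite !ler0_norm ?lerN2// ltW.
Qed.

Lemma zero_partial_connected_cst (R : realType) r m n
    (h : 'rV[R]_r -> 'M[R]_(m, n)) (U : set 'rV[R]_r) :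
  open U -> connected U ->
  (forall x, U x -> forall a, is_derive x (delta_mx 0 a) h 0) ->
  forall x y, U x -> U y -> h x = h y.
Proof.
move=> Uo Uc dh x y Ux Uy.
have loc z : U z -> \forall w \near z, U w /\ h w = h z.
  move=> Uz; have /nbhs_ballP[e /= e0 eU] := open_nbhs_nbhs (conj Uo Uz).
  apply/nbhs_ballP; exists e => //= w zw; split; first exact: eU.
  by apply: (zero_partial_ball_cst (e := e)) => // v /eU; exact: dh.
(* Local constancy makes this open for every [P]: equality with [h x] gives the open condition of
   connectedness, inequality the closed one. *)
have open_level (P : set 'M[R]_(m, n)) : open [set z | U z /\ P (h z)].
  rewrite openE => z [Uz Pz]; apply: filterS (loc z Uz) => w [Uw hw].
  by split=> //; rewrite hw.
suff UE : [set z | U z /\ h z = h x] = U by move: Uy; rewrite -UE => -[_ ->].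
apply: Uc.
- by exists x.
- exists [set z | U z /\ h z = h x]; first exact: (open_level [set h x]).
  by apply/seteqP; split=> z /= [? ?].
- exists (~` [set z | U z /\ h z <> h x]).
    exact/open_closedC/(open_level [set w | w <> h x]).
  apply/seteqP; split=> z /= [Uz hz]; split=> //; first by case.
  by apply: contrapT => nhz; exact: hz.
Qed.

(** * Derivatives of transposes and exponentials; the theorem *)

Lemma is_derive_trmx (R : realType) (V : normedModType R) m n
    (F : V -> 'M[R]_(m, n)) t v dF :
  is_derive t v F dF -> is_derive t v (fun s => (F s)^T) dF^T.
Proof.
move=> /is_derive_mxP dFt; apply/is_derive_mxP => i j; rewrite mxE.
by under eq_fun do rewrite mxE.
Qed.

(** Along the line the addition law splits off the constant factor [mxexp (L x)], leaving the
    derivative of [mxexp (s *: B)] at 0. *)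
Lemma is_derive_mxexp_affine (R : realType) (V : normedModType R) n
    (L : V -> 'M[R]_n) (B : 'M[R]_n) x v :
  (forall s : R, L (s *: v + x) = s *: B + L x) -> B *m L x = L x *m B ->
  is_derive x v (fun y => mxexp (L y)) (B *m mxexp (L x)).
Proof.
move=> Lv BL; apply/is_derive_lineP.
rewrite (_ : (fun s => _) = fun s : R => mxexp (L x) *m mxexp (s *: B)).
  apply: (is_derive_eq (is_derive_mulmx (is_derive_cst _ _ _) (is_derive_mxexp _ _))).
  by rewrite mul0mx add0r scale0r mxexp0 mulmx1 comm_mxexp.
by apply/funext => s; rewrite Lv mxexpD// -scalemxAr -scalemxAl BL.
Qed.

Unset Implicit Arguments.

Theorem lemma1 (R : realType) (n r : nat) (hr : (1 <= r <= n - 1)%N)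
    (A : 'I_r -> 'M[R]_n) (hA : forall a b : 'I_r, A a *m A b = A b *m A a)
    (U : set 'rV[R]_r) (hUo : open U) (hUc : connected U)
    (g : 'rV[R]_r -> 'M[R]_n)
    (hsym : forall xi : 'rV[R]_r, U xi -> Sym R n (g xi))
    (hg : forall xi : 'rV[R]_r, U xi ->
      forall a : 'I_r, has_partial g a xi (A a *m g xi)) :
  exists g0 : 'M[R]_n,
    (forall a : 'I_r, A a *m g0 = g0 *m (A a)^T) /\
    (forall xi : 'rV[R]_r, U xi ->
       g xi = mxexp (\sum_(a < r) xi 0 a *: A a) *m g0).
Proof.
(* An empty [U] offers no base point, and [g0 = 0] works there. *)
have [->|/set0P[x0 Ux0]] := eqVneq U set0.
  by exists 0; split=> // a; rewrite mulmx0 mul0mx.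
pose S (xi : 'rV[R]_r) := \sum_(a < r) xi 0 a *: A a.
have commS a xi : A a *m S xi = S xi *m A a.
  rewrite mulmx_sumr mulmx_suml; apply: eq_bigr => b _.
  by rewrite -scalemxAr -scalemxAl hA.
have commNS a xi : A a *m - S xi = - S xi *m A a by rewrite mulmxN mulNmx commS.
have S_line a (s : R) xi : S (s *: delta_mx 0 a + xi) = s *: A a + S xi.
  rewrite /S; under eq_bigr do rewrite !mxE/= scalerDl.
  rewrite big_split/= (bigD1 a)//= eqxx mulr1 big1 ?addr0// => b /negPf->.
  by rewrite mulr0 scale0r.
pose h xi := mxexp (- S xi) *m g xi.
have h_partial xi : U xi -> forall a, is_derive xi (delta_mx 0 a) h 0.
  move=> Uxi a.
  have dE : is_derive xi (delta_mx 0 a) (fun y => mxexp (- S y))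
      (- A a *m mxexp (- S xi)).
    apply: is_derive_mxexp_affine => [s|]; last by rewrite mulNmx commNS mulmxN.
    by rewrite S_line opprD scalerN.
  apply: (is_derive_eq (is_derive_mulmx dE (hg xi Uxi a))).
  by rewrite mulmxA -comm_mxexp// !mulNmx addNr.
have h_cst xi : U xi -> h xi = h x0.
  by move=> Uxi; apply: (zero_partial_connected_cst hUo hUc).
exists (h x0); split=> [a|xi Uxi]; last first.
  by rewrite -(h_cst xi)// /h -/(S xi) mulmxA -{1}[S xi]opprK mulNmxexp mul1mx.
(* As [U] is open, [g] equals its transpose near [x0], so both sides are the same partial derivative
   of [g] at [x0]. *)
have Ag_sym : (A a *m g x0)^T = A a *m g x0.
  have dg := hg _ Ux0 a.
  have dgT : is_derive x0 (delta_mx 0 a) g (A a *m g x0)^T.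
    apply: near_eq_is_derive (is_derive_trmx dg); near=> y; apply: hsym.
    by near: y; exact: open_nbhs_nbhs.
  exact: etrans (esym (@derive_val _ _ _ _ _ _ _ dgT)) (@derive_val _ _ _ _ _ _ _ dg).
(* With E = exp (- S x0): A E g = E (A g) = E (A g)^T = E g A^T. *)
rewrite /h mulmxA comm_mxexp// -mulmxA -Ag_sym trmx_mul (hsym _ Ux0).
by rewrite mulmxA.
Unshelve. all: by end_near. Qed.
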